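(* If $G$ is a subcubic graph with girth at least $8$ and $\mathrm{mad}(G) < 2 + \frac{2}{23}$, then $\chi_{s}'(G) \leq 5$.
   Context: All graphs are simple, finite and undirected. A graph is subcubic if its maximum degree is at most $3$. A strong edge coloring of a graph is a proper edge coloring in which every color class is an induced matching. The strong chromatic index $\chi_{s}'(G)$ is the minimum number of colors in a strong edge coloring of $G$. The maximum average degree of $G$ is $\mathrm{mad}(G) = \max_{\emptyset \neq H \subseteq G} \frac{2|E(H)|}{|V(H)|}$, the maximum being over nonempty subgraphs $H$ of $G$. The girth of a graph is the length of a shortest cycle (infinite if the graph has no cycle). *)

(* Defs.v *)
From HB Require Import structures.
From mathcomp Require Import all_boot all_order all_algebra.

Set Implicit Arguments.
Unset Strict Implicit.
Unset Printing Implicit Defensive.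

Import Order.TTheory GRing.Theory Num.Theory.

Record sgraph := SGraph {
  vertex :> finType;
  adj : rel vertex;
  adj_sym : symmetric adj;
  adj_irr : irreflexive adj }.

Section Graph.
Variable G : sgraph.
Implicit Types (x y : G) (e f : {set G}) (M : {set {set G}}).

Definition edges : {set {set G}} :=
  [set e : {set G} | [exists x, exists y, adj x y && (e == [set x; y])]].

Lemma edgesP e :
  reflect (exists x y, adj x y /\ e = [set x; y]) (e \in edges).
Proof.
rewrite inE; apply: (iffP existsP).
  by move=> [x /existsP[y /andP[xy /eqP->]]]; exists x, y.
by move=> [x [y [xy ->]]]; exists x; apply/existsP; exists y; rewrite xy eqxx.
Qed.

Lemma card_edge e : e \in edges -> #|e| = 2.
Proof.
move=> /edgesP[x [y [xy ->]]]; rewrite cards2.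
by case: eqP xy => // ->; rewrite adj_irr.
Qed.

Definition degree x : nat := #|[set y | adj x y]|.

Definition max_degree : nat := \max_(x : G) degree x.

Definition subcubic : bool := max_degree <= 3.

(* An arbitrary (not necessarily induced) subgraph, as a pair (V(H), E(H)). *)
Definition subgraph (H : {set G} * {set {set G}}) : bool :=
  (H.2 \subset edges) && [forall e in H.2, e \subset H.1].

(* The densities are nonnegative, so the index 0 does not affect the maximum when
   G has a vertex; mad is 0 by convention when it has none. *)
Definition mad : rat :=
  (\big[Num.max/0]_(H : {set G} * {set {set G}} | subgraph H && (H.1 != set0))
     ((2 * #|H.2|)%:R / #|H.1|%:R))%R.

(* The condition 2 < k is needed: ucycle accepts the empty sequence, and [:: x; y]
   for any edge xy. *)
Definition has_cycle_of_length (k : nat) : bool :=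
  (2 < k) && [exists c : k.-tuple G, ucycleb (@adj G) c].

(* None stands for infinity; a cycle has at most #|G| vertices, so it is enough
   to search the lengths up to #|G|. *)
Definition girth : option nat :=
  if [pick k : 'I_#|G|.+1 | has_cycle_of_length k] is Some k0
  then Some (val [arg min_(k < k0 | has_cycle_of_length k) (val k)])
  else None.

Definition girth_geq (g : nat) : bool :=
  if girth is Some k then g <= k else true.

Lemma girth_geqP g :
  reflect (forall c : seq G, 2 < size c -> ucycle (@adj G) c -> g <= size c)
          (girth_geq g).
Proof.
rewrite /girth_geq /girth; case: pickP => [k0 hk0|no].
  case: arg_minnP => // k hk kmin; apply: (iffP idP) => [gk c c2 uc|H].
    have lt : size c < #|G|.+1.
      by rewrite ltnS -(card_uniqP (andP uc).2) max_card.
    apply: leq_trans gk _; apply: (kmin (Ordinal lt)) => /=.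
    by rewrite /has_cycle_of_length c2; apply/existsP; exists (in_tuple c).
  case/andP: hk => k2 /existsP[c uc].
  by have := H c; rewrite size_tuple; apply.
constructor=> c c2 uc.
have lt : size c < #|G|.+1.
  by rewrite ltnS -(card_uniqP (andP uc).2) max_card.
have /negP[] := negbT (no (Ordinal lt)).
by rewrite /has_cycle_of_length c2; apply/existsP; exists (in_tuple c).
Qed.

Definition matching M : bool := (M \subset edges) && trivIset M.

(* M is exactly the edge set of the subgraph of G induced by the vertices
   covered by M. *)
Definition induced_matching M : bool :=
  matching M && ([set e in edges | e \subset cover M] == M).

Definition edge := {e : {set G} | e \in edges}.

Section Coloring.
Variables (k : nat) (c : {ffun edge -> 'I_k}).

Definition proper_edge_coloring : bool :=
  [forall e : edge, forall f : edge,
     (e != f) && ~~ [disjoint val e & val f] ==> (c e != c f)].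

Definition color_class (i : 'I_k) : {set {set G}} :=
  [set val e | e : edge & c e == i].

Definition strong_edge_coloring : bool :=
  proper_edge_coloring && [forall i, induced_matching (color_class i)].

End Coloring.

Definition strong_edge_colorable (k : nat) : bool :=
  [exists c : {ffun edge -> 'I_k}, strong_edge_coloring c].

Lemma strong_edge_colorable_ex : exists k, strong_edge_colorable k.
Proof.
exists #|{: edge}|; apply/existsP; exists [ffun e => enum_rank e].
apply/andP; split.
  apply/forallP=> e; apply/forallP=> f; apply/implyP=> /andP[ef _].
  by rewrite !ffunE (inj_eq enum_rank_inj).
apply/forallP=> i.
have -> : color_class [ffun e => enum_rank e] i = [set val (enum_val i)].
  apply/setP=> e; rewrite inE; apply/imsetP/eqP => [[f]|->].
    by rewrite inE ffunE => /eqP <- ->; rewrite enum_rankK.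
  by exists (enum_val i); rewrite // inE ffunE enum_valK.
case: (enum_val i) => /= e eE.
have cov : cover [set e] = e by rewrite /cover big_set1.
rewrite /induced_matching /matching -andbA; apply/and3P; split.
- by rewrite sub1set.
- by rewrite /trivIset big_set1 cov.
- apply/eqP/setP=> f; rewrite cov !inE; apply/andP/eqP => [[fE fe]|->].
    by apply/eqP; rewrite eqEcard fe !card_edge // inE.
  by split=> //; move: eE; rewrite inE.
Qed.

Definition strong_chromatic_index : nat := ex_minn strong_edge_colorable_ex.

End Graph.

(* Main.v *)
Require Import Defs.
From mathcomp Require Import all_boot all_order all_algebra.
From mathcomp Require Import zify lra.

Set Implicit Arguments.
Unset Strict Implicit.
Unset Printing Implicit Defensive.

(** Why the theorem holds.  Map the vertices of G to those of the Petersen graph,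
    the 2-subsets of {0, ..., 4} with disjointness as adjacency, in such a way
    that adjacent vertices go to adjacent vertices and two neighbours of a common
    vertex go to different vertices.  Colour an edge by the element of
    {0, ..., 4} missing from the two disjoint pairs at its ends.  In the Petersen
    graph this colouring of the edges is strong, and a locally injective map
    sends paths with two or three edges to paths of the same length, so it pulls
    back to a strong 5-edge-colouring of G ([petersen_map_colorable]).

    The map is built on induced subgraphs G[S], by induction on the size of S.
    A vertex with at most one neighbour in S can be mapped last, because its
    neighbour has three places around its image and at most two are taken
    ([extend_leaf]).  Otherwise all degrees in G[S] are 2 or 3.  If S has n2 and
    n3 vertices of these degrees, then mad G < 2 + 2/23 gives 21 n3 < 2 n2
    ([mad_sum_nbr]).
    Now start at a dart that enters a vertex of degree 2 and go backwards until
    a dart that leaves a vertex of degree 3 is reached.  There are 2 n2 starting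
    darts but only 3 n3 final ones, and the start is determined by the final dart
    and the number of steps.  So some dart needs at least seven steps: there is a
    walk x0, ..., x9 without reversals whose vertices x1, ..., x8
    have degree 2 ([exists_thread]).

    Remove x2, ..., x7 and map the rest by induction.  In the Petersen graph any
    dart leads to any other dart by a walk without reversals that has exactly
    seven edges in between ([petersen_walk]); the walk from the dart
    (phi x0, phi x1) to the dart (phi x8, phi x9) gives the images of the removed
    vertices ([extend_thread]).  Girth 8 enters here: any eight consecutive
    vertices of a walk without reversals are distinct ([nb_walk_inj]).  So
    x2, ..., x7 are distinct, and none of them is one of x0, x1, x8, x9.  The
    walk may still close up, for instance when G[S] has a component that is an
    8-cycle and (x8, x9) = (x0, x1), and the argument covers this as it stands. *)

(** * Non-reversing walks *)

(** A walk x 0, ..., x n that never turns back along the edge just used.  Walks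
    are total functions on nat, of which only the values up to n matter; this
    suits walks obtained by iterating a map. *)
Definition nb_walk (T : Type) (e : rel T) (x : nat -> T) n :=
  (forall i, i < n -> e (x i) (x i.+1)) /\
  (forall i, i.+1 < n -> x i <> x i.+2).

(** * The Petersen graph *)

(** The pair (i, j) with i < j < 5 stands for the subset {i, j}. *)
Definition petersen : seq (nat * nat) :=
  [seq (i, j) | j <- iota 0 5, i <- iota 0 j].

Definition padj (p q : nat * nat) : bool :=
  [&& p \in petersen, q \in petersen,
      p.1 != q.1, p.1 != q.2, p.2 != q.1 & p.2 != q.2].

(** The element of {0, ..., 4} outside both pairs: all five add up to 10.
    Written with a sum, it is visibly symmetric in the two ends of an edge. *)
Definition fifth (p q : nat * nat) : nat := 10 - (p.1 + p.2 + (q.1 + q.2)).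

Lemma padj_mem p q : padj p q -> p \in petersen /\ q \in petersen.
Proof. by case/and3P. Qed.

Lemma padj_sym : symmetric padj.
Proof.
move=> p q; rewrite /padj andbCA; congr [&& _, _ & _].
rewrite ![q.1 == _]eq_sym ![q.2 == _]eq_sym.
by case: (p.1 == q.1); case: (p.1 == q.2); case: (p.2 == q.1).
Qed.

Definition pnbr p := [seq q <- petersen | padj p q].

Lemma mem_pnbr p q : (q \in pnbr p) = padj p q.
Proof.
rewrite mem_filter; apply/andb_idr => /padj_mem[_ ->] //.
Qed.

Lemma pnbr_size p : p \in petersen -> size (pnbr p) = 3.
Proof.
move=> pP; apply/eqP; move: p pP; apply/allP; by vm_compute.
Qed.

Lemma fifth_lt p q : padj p q -> fifth p q < 5.
Proof.
move=> pq; have [pP qP] := padj_mem pq; apply: (implyP _ pq).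
move: q qP {pq}; apply/allP; move: p pP; apply/allP.
by vm_compute.
Qed.

(** Two edges that leave p lead to different pairs in the complement of p, hence
    have different missing elements.  The facts on the ten
    vertices are checked by evaluating them on the lists of vertices and
    neighbours. *)
Lemma fifth_adjacent p q r : padj p q -> padj p r -> q <> r ->
  fifth p q <> fifth p r.
Proof.
rewrite -!mem_pnbr => pq pr /eqP qr; apply/eqP; apply: (implyP _ qr).
have pP : p \in petersen by move: pq; rewrite mem_pnbr => /padj_mem[].
move: r pr {qr}; apply/allP; move: q pq; apply/allP; move: p pP; apply/allP.
by vm_compute.
Qed.

(** The colour of p q lies outside q, so it is in r or it is the colour of q r.
    The latter is excluded by p <> r, and the colour of r s is not in r. *)
Lemma fifth_distance2 p q r s : padj p q -> padj q r -> padj r s ->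
  p <> r -> fifth p q <> fifth r s.
Proof.
rewrite -!mem_pnbr => pq qr rs /eqP pr; apply/eqP; apply: (implyP _ pr).
have pP : p \in petersen by move: pq; rewrite mem_pnbr => /padj_mem[].
move: s rs; apply/allP; move: r qr {pr}; apply/allP.
move: q pq; apply/allP; move: p pP; apply/allP; by vm_compute.
Qed.

(** The darts at the end of a non-reversing walk of n steps from the dart d; a
    dart is an ordered pair of adjacent vertices. *)
Fixpoint reach n (d : (nat * nat) * (nat * nat)) :=
  if n is n'.+1 then
    undup [seq (d'.2, r) | d' <- reach n' d, r <- [seq r <- pnbr d'.2 | r != d'.1]]
  else [:: d].

Lemma reach_walk n p q r s : padj p q -> (r, s) \in reach n (p, q) ->
  exists y, [/\ nb_walk padj y n.+1, y 0 = p, y 1 = q, y n = r & y n.+1 = s].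
Proof.
move=> pq; elim: n r s => [|n IH] r s /=.
  rewrite inE => /eqP[-> ->]; exists (fun i => if i is 0 then p else q).
  by split=> //; split=> -[|i].
rewrite mem_undup => /allpairsPdep[[r0 s0] [t [/IH[y [[ya yn] y0 y1 yr ys]]]]] /=.
rewrite mem_filter mem_pnbr => /andP[tr st] [-> ->].
exists (fun i => if i <= n.+1 then y i else t); split=> //=.
- split=> i.
    rewrite ltnS => i_le; rewrite i_le; case: ltnP => [/ya//|ni].
    by have -> : i = n.+1; [apply/eqP; rewrite eqn_leq i_le | rewrite ys].
  rewrite ltnS => i_le; rewrite (ltnW i_le); case: ltnP => [/yn//|ni].
  have -> : i = n by apply/eqP; rewrite eqn_leq -!(ltnS _ n) i_le.
  by rewrite yr => E; rewrite E eqxx in tr.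
- by rewrite leqnn.
- by rewrite ltnn.
Qed.

(** Each step doubles the number of continuations, so eight steps give 256 walks
    from a given dart, and they end at all 30 darts.  This length
    is what lets threads with eight inner vertices be reduced, hence the
    constant 23: with at most seven per thread, the average degree is at least
    2 + 1 / (1 + 7 * 3 / 2) = 2 + 2 / 23. *)
Lemma petersen_walk p q r s : padj p q -> padj r s ->
  exists y, [/\ nb_walk padj y 9, y 0 = p, y 1 = q, y 8 = r & y 9 = s].
Proof.
move=> pq rs; apply: (reach_walk (n := 8)) => //.
move: pq rs; rewrite -!mem_pnbr => pq rs.
have pP : p \in petersen by move: pq; rewrite mem_pnbr => /padj_mem[].
have rP : r \in petersen by move: rs; rewrite mem_pnbr => /padj_mem[].
pose covers (R : seq ((nat * nat) * (nat * nat))) :=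
  all (fun r => all (fun s => (r, s) \in R) (pnbr r)) petersen.
suff : covers (reach 8 (p, q)) by move/allP => /(_ r rP)/allP/(_ s rs).
move: q pq; apply/allP; move: p pP; apply/allP.
by vm_compute.
Qed.

(** * Extending maps to the Petersen graph *)

Section Graph.
Variable G : sgraph.
Implicit Types (x y z : G) (S : {set G}).

(** If the walk returns at x j = x i with j - i minimal, the vertices from x i to
    x (j - 1) form a cycle: having no reversal excludes length 2. *)
Lemma nb_walk_inj (x : nat -> G) g n i j : girth_geq G g ->
  nb_walk (@adj G) x n -> i < j <= n -> j - i < g -> x i <> x j.
Proof.
move=> /girth_geqP gG [xa xn].
have [k] := ubnP (j - i); elim: k i j => // k IH i j ltk /andP[ij jn] ltg xij.
have U : uniq [seq x l | l <- iota i (j - i)].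
  rewrite map_inj_in_uniq ?iota_uniq // => a b.
  rewrite !mem_iota => /andP[ia aj] /andP[ib bj] xab.
  by case: (ltngtP a b) => // ab; [case: (IH a b) | case: (IH b a)];
    rewrite ?xab //; lia.
case: (ltnP 2 (j - i)) => [j2|].
  suff C : cycle (@adj G) [seq x l | l <- iota i (j - i)].
    by have := gG _ _ (introT andP (conj C U)); rewrite size_map size_iota; lia.
  have -> : j - i = (j - i).-1.+1 by lia.
  rewrite /= rcons_path; apply/andP; split.
    apply/(pathP (x i)) => a; rewrite size_map size_iota => aj.
    rewrite (nth_map 0) ?size_iota // nth_iota //.
    case: a aj => [|a] aj /=; first by rewrite addn0; apply: xa; lia.
    rewrite (nth_map 0) ?size_iota ?nth_iota ?addSnnS; try lia.
    by rewrite !addnS; apply: xa; lia.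
  rewrite (last_map x) xij.
  have -> : last i (iota i.+1 (j - i).-1) = j.-1.
    by rewrite -nth_last size_iota nth_iota; lia.
  have {2}-> : j = j.-1.+1 by lia.
  by apply: xa; lia.
move=> le2; have [E|E] : j = i.+1 \/ j = i.+2 by lia.
  by have := xa i; rewrite -E xij adj_irr => /(_ jn).
by apply: (xn i); rewrite -E.
Qed.

Definition nbr S x := [set y in S | adj x y].

Lemma nbr_le3 S x : subcubic G -> #|nbr S x| <= 3.
Proof.
move=> sG; apply: leq_trans (leq_trans (leq_bigmax x) sG).
by apply/subset_leq_card/subsetP => y; rewrite !inE => /andP[].
Qed.

(** A locally injective homomorphism from G[S] to the Petersen graph.  The first
    condition matters for isolated vertices of G[S]: a neighbour attached to one
    of them needs a place around its image. *)
Definition petersen_map S (phi : G -> nat * nat) :=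
  [/\ forall x, phi x \in petersen,
      {in S &, forall x y, adj x y -> padj (phi x) (phi y)} &
      {in S & &, forall x y z, adj x y -> adj x z -> y != z -> phi y <> phi z}].

(** The image of x must be adjacent to that of its neighbour u and avoid those of
    the other neighbours of u, of which there are at most two. *)
Lemma extend_leaf S x phi : subcubic G -> x \in S -> #|nbr S x| <= 1 ->
  petersen_map (S :\ x) phi -> exists psi, petersen_map S psi.
Proof.
move=> sG xS dx [phiP phiA phiI].
(* The pair b is a suitable image of x, if u is the neighbour of x. *)
have key u : {b | b \in petersen /\ (u \in nbr S x -> padj (phi u) b /\
    {in S :\ x, forall y, adj u y -> phi y <> b})}.
  case ux: (u \in nbr S x); last by exists (0, 1).
  pose F := [seq phi y | y <- enum (nbr S u :\ x)].
  have : ~~ all (mem F) (pnbr (phi u)).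
    apply/negP => /allP sub.
    have /(uniq_leq_size _) := sub; rewrite filter_uniq // => /(_ isT).
    rewrite pnbr_size // size_map -cardE.
    have := nbr_le3 S u sG; rewrite (cardsD1 x) !inE xS.
    by move: ux; rewrite !inE adj_sym => /andP[_ ->]; lia.
  rewrite -has_predC => /hasP/sig2W[b]; rewrite mem_pnbr => bA bF.
  exists b; split; first by case/padj_mem: bA.
  move=> _; split=> // y; rewrite !inE => /andP[yx yS] uy E.
  by case/negP: bF; rewrite /= -E map_f // mem_enum !inE yx yS.
have [b bP] : {b | b \in petersen /\ forall u, u \in nbr S x -> padj (phi u) b /\
    {in S :\ x, forall y, adj u y -> phi y <> b}}.
  case: (pickP (mem (nbr S x))) => [u /= ux|no].
    have [b [bP bu]] := key u; exists b; split=> // v vx.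
    suff -> : v = u by apply: bu.
    by move/card_le1P: dx => /(_ u ux v); rewrite vx inE => /esym/eqP.
  by exists (0, 1); split=> // u ux; have := no u; rewrite /= ux.
case: bP => bP bu.
exists (fun y => if y == x then b else phi y); split.
- by move=> y; case: eqP.
- move=> y z yS zS yz.
  case: (eqVneq y x) => yx; case: (eqVneq z x) => zx.
  + by move: yz; rewrite yx zx adj_irr.
  + by rewrite padj_sym; apply: (bu z _).1; rewrite inE zS -yx.
  + by apply: (bu y _).1; rewrite inE yS adj_sym -zx.
  + by apply: phiA; rewrite // !inE ?yx ?zx.
- move=> u y z uS yS zS uy uz yz.
  case: (eqVneq y x) => yx; case: (eqVneq z x) => zx.
  + by case/eqP: yz; rewrite yx.
  + move=> E; apply: ((bu u _).2 z) => //; first by rewrite inE uS -yx adj_sym.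
    by rewrite !inE zx.
  + apply: (bu u _).2 => //; first by rewrite inE uS -zx adj_sym.
    by rewrite !inE yx.
  + case: (eqVneq u x) => ux.
      move/card_le1P: dx => /(_ y); rewrite inE yS -ux uy => /(_ isT z).
      by rewrite !inE zS uz => /esym/eqP zy; rewrite zy eqxx in yz.
    by apply: (phiI u); rewrite // !inE ?ux ?yx ?zx.
Qed.

(** The inner vertices x 1, ..., x n have degree 2 in G[S]; the ends x 0 and
    x n.+1 may coincide with each other or with inner vertices. *)
Definition thread S (x : nat -> G) n :=
  [/\ nb_walk (@adj G) x n.+1, forall i, i <= n.+1 -> x i \in S &
      forall i, 0 < i <= n -> #|nbr S (x i)| = 2].

Lemma thread_nbr S (x : nat -> G) n i z : thread S x n -> i < n -> z \in S ->
  adj (x i.+1) z -> z = x i \/ z = x i.+2.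
Proof.
move=> [[xa xn] xS xd] i_n zS xz.
have ne : x i != x i.+2 by apply/eqP/xn.
have sub : [set x i; x i.+2] \subset nbr S (x i.+1).
  apply/subsetP => u; rewrite !inE => /orP[] /eqP->.
    by rewrite xS 1?adj_sym ?xa //; lia.
  by rewrite xS ?xa //; lia.
have /eqP E : [set x i; x i.+2] == nbr S (x i.+1).
  by rewrite eqEcard sub xd //= cards2 ne.
have : z \in nbr S (x i.+1) by rewrite inE zS.
by rewrite -E !inE => /orP[] /eqP; [left|right].
Qed.

(** Only x 2, ..., x 7 receive new images.  The darts (x 0, x 1) and (x 8, x 9) keep
    their images, so the constraints around x 0 and x 9 remain satisfied, and
    those around x 1, ..., x 8 say that the images form a non-reversing walk. *)
Lemma extend_thread S (x : nat -> G) phi : girth_geq G 8 -> thread S x 8 ->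
  petersen_map (S :\: [set x i | i : 'I_10 & 1 < i < 8]) phi ->
  exists psi, petersen_map S psi.
Proof.
set X := [set _ | _ in _] => gG tx [phiP phiA phiI].
have [xw xS xd] := tx; have [xa xn] := xw.
have memX i : 1 < i < 8 -> x i \in X.
  move=> i18; have i10 : i < 10 by lia.
  by apply/imsetP; exists (Ordinal i10); rewrite ?inE.
(* An end vertex and a removed one are at most seven steps apart. *)
have notX i : i <= 9 -> ~~ (1 < i < 8) -> x i \notin X.
  move=> i9 ni; apply/imsetP => -[[j j10]]; rewrite inE /= => j18 E.
  have [ij|ji] : i < j \/ j < i by lia.
    by apply: (nb_walk_inj (i := i) (j := j) gG xw) E; lia.
  by apply: (nb_walk_inj (i := j) (j := i) gG xw) (esym E); lia.
have xS' i : i <= 9 -> ~~ (1 < i < 8) -> x i \in S :\: X.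
  by move=> i9 ni; rewrite inE notX ?xS.
have [||y [[ya yn] y0 y1 y8 y9]] := @petersen_walk (phi (x 0)) (phi (x 1))
    (phi (x 8)) (phi (x 9)).
- by apply: phiA; rewrite ?xS' ?xa.
- by apply: phiA; rewrite ?xS' ?xa.
have yP i : i <= 9 -> y i \in petersen.
  by case: i => [_|i /ya/padj_mem[]//]; case/padj_mem: (ya 0 isT).
(* The index found is unique, because x 2, ..., x 7 are distinct. *)
pose psi z := if [pick i : 'I_10 | (1 < i < 8) && (x i == z)] is Some i
              then y i else phi z.
have psiN z : z \notin X -> psi z = phi z.
  move=> zX; rewrite /psi; case: pickP => // i /andP[i18 /eqP E].
  by case/negP: zX; rewrite -E memX.
have psix i : i <= 9 -> psi (x i) = y i.
  move=> i9; case i18: (1 < i < 8); last first.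
    rewrite psiN ?notX ?i18 //.
    have : i = 0 \/ i = 1 \/ i = 8 \/ i = 9 by lia.
    by case=> [->|[->|[->|->]]].
  rewrite /psi; case: pickP => [j /andP[j18 /eqP E]|/(_ (Ordinal (i9 : i < 10)))].
    congr y; case: (ltngtP j i) => // ij.
      by case: (nb_walk_inj (i := j) (j := i) gG xw _ _ E); lia.
    by case: (nb_walk_inj (i := i) (j := j) gG xw _ _ (esym E)); lia.
  by rewrite /= i18 eqxx.
(* The neighbours in S of the removed vertices are on the thread. *)
have Xnbr u v : u \in X -> v \in S -> adj u v ->
    exists2 i, 0 < i < 7 & u = x i.+1 /\ (v = x i \/ v = x i.+2).
  case/imsetP=> -[[|i] i10]; rewrite inE /= => // i18 -> vS uv.
  by exists i; [lia | split=> //; apply: (thread_nbr tx) uv => //; lia].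
have psiA : {in S &, forall u v, u \in X -> adj u v -> padj (psi u) (psi v)}.
  move=> u v uS vS uX /(Xnbr _ _ uX vS)[i i8 [-> [->|->]]].
    by rewrite !psix ?(padj_sym _ (y i)) ?ya //; lia.
  by rewrite !psix ?ya //; lia.
exists psi; split.
- by move=> z; rewrite /psi; case: pickP => [i _|_]; rewrite ?yP // -ltnS.
- move=> u v uS vS uv; case uX: (u \in X); first exact: psiA.
  case vX: (v \in X); first by rewrite padj_sym psiA // adj_sym.
  by rewrite !psiN ?uX ?vX // phiA // inE ?uX ?vX.
- move=> u v w uS vS wS uv uw vw.
  case: (pickP [pred i : 'I_8 | x i.+1 == u]) => [[i i8] /= /eqP E|no].
    move: uv uw; rewrite -E => uv uw.
    have psine : psi (x i) <> psi (x i.+2).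
      by rewrite !psix //; [apply: yn | lia].
    have [Ev|Ev] := thread_nbr tx i8 vS uv;
      have [Ew|Ew] := thread_nbr tx i8 wS uw; rewrite Ev Ew ?eqxx // in vw *.
    exact: nesym.
  (* Away from x 1, ..., x 8, the vertex u and its neighbours were kept. *)
  have inN v' : v' \in S -> adj u v' -> v' \notin X.
    move=> v'S uv'; apply/negP => v'X; rewrite adj_sym in uv'.
    have [i i7 [_ [Eu|Eu]]] := Xnbr _ _ v'X uS uv'; last first.
      have i8 : i.+1 < 8 by case/andP: i7.
      by have := no (Ordinal i8); rewrite /= Eu eqxx.
    case: i i7 Eu => [//|i] i7 Eu; have i8 : i < 8 by rewrite leqW // ltnW.
    by have := no (Ordinal i8); rewrite /= Eu eqxx.
  have uX : u \notin X.
    apply/negP => /imsetP[[[|i] i10]]; rewrite inE /= => // i18 E.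
    have i8 : i < 8 by case/andP: i18 => _; apply: ltnW.
    by have := no (Ordinal i8); rewrite /= E eqxx.
  by rewrite !psiN ?inN //; apply: (phiI u); rewrite // in_setD ?uX ?(inN v) ?(inN w).
Qed.

(** * Long threads *)

Definition darts S := [set d : G * G | [&& d.1 \in S, d.2 \in S & adj d.1 d.2]].
Definition darts_from S k := [set d in darts S | #|nbr S d.1| == k].
Definition darts_into S k := [set d in darts S | #|nbr S d.2| == k].

(** One step of a non-reversing walk.  It is meant for darts that enter a vertex
    of degree 2, where the continuation is unique; the default turns back. *)
Definition forward S (d : G * G) : G * G :=
  (d.2, odflt d.1 [pick z in nbr S d.2 | z != d.1]).

Definition of_degree S k := [set x in S | #|nbr S x| == k].

Lemma card_darts_from S k : #|darts_from S k| = k * #|of_degree S k|.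
Proof.
have -> : #|darts_from S k| = \sum_(x in of_degree S k) \sum_(y in nbr S x) 1.
  rewrite pair_big_dep -sum1_card; apply: eq_bigl => d.
  rewrite !inE; case: (d.1 \in S) => //=.
  by case: (d.2 \in S); case: (adj d.1 d.2); rewrite ?andbF ?andbT.
rewrite mulnC -sum_nat_const; apply: eq_bigr => x.
by rewrite inE sum1_card => /andP[_ /eqP].
Qed.

Lemma card_darts_into S k : #|darts_into S k| = k * #|of_degree S k|.
Proof.
rewrite -card_darts_from -(card_imset _ (can_inj (@swap_pairK G G))).
apply: eq_card => -[x y]; rewrite 2!inE /= adj_sym.
apply/imsetP/andP => [[[u v]]|[/and3P[xS yS yx] d]].
  by rewrite !inE /= => /andP[/and3P[uS vS uv] d] [-> ->]; rewrite uS vS uv.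
by exists (y, x); rewrite ?inE //= yS xS yx.
Qed.

Lemma forward_dart S d : d \in darts_into S 2 ->
  forward S d \in darts S /\ (forward S d).2 != d.1.
Proof.
case: d => x y; rewrite !inE /= => /andP[/and3P[xS yS xy] /eqP d2].
case: pickP => [z /= /andP[]|no].
  by rewrite inE => /andP[zS yz] zx; rewrite yS zS yz.
have : #|nbr S y| <= #|[set x]|.
  apply/subset_leq_card/subsetP => z zy; rewrite inE.
  by have := no z; rewrite /= zy => /negbFE.
by rewrite d2 cards1.
Qed.

Lemma forward_onto S d : d.1 \in [set x | #|nbr S x| == 2] -> d \in darts S ->
  exists2 d', d' \in darts_into S 2 & forward S d' = d.
Proof.
case: d => x y; rewrite !inE /= => /eqP d2 /and3P[xS yS xy].
have yx : y \in nbr S x by rewrite inE yS.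
have /cards1P[w Ew] : #|nbr S x :\ y| == 1.
  by rewrite -eqSS -add1n -d2 (cardsD1 y (nbr S x)) yx.
have : w \in nbr S x :\ y by rewrite Ew inE.
rewrite !inE => /and3P[wy wS xw].
exists (w, x); first by rewrite !inE /= wS xS adj_sym xw d2.
rewrite /forward /=; congr pair; case: pickP => [z /= /andP[zx zw]|/(_ y)/=].
  apply: contraNeq zw => zy; suff : z \in nbr S x :\ y by rewrite Ew inE.
  by rewrite in_setD1 zy.
by rewrite yx eq_sym wy.
Qed.

(** Walking backwards from d stops only when a vertex of degree 3 is left: from a
    vertex of degree 2 there is exactly one way back. *)
Lemma backtrack S k d : (forall x, x \in S -> 1 < #|nbr S x| <= 3) ->
  d \in darts_into S 2 ->
  (exists2 j, j < k & exists2 d', d' \in darts_from S 3 & iter j (forward S) d' = d) \/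
  (exists2 d', iter k (forward S) d' = d &
     forall i, i <= k -> iter i (forward S) d' \in darts_into S 2).
Proof.
move=> deg dD; elim: k => [|k [[j jk E]|[d' Ed' dd']]].
- by right; exists d => // -[].
- by left; exists j => //; apply: leqW.
have := dd' 0 isT; rewrite inE /= => /andP[d'D _].
have d'S : d'.1 \in S by move: d'D; rewrite inE => /andP[].
have [d2|d3] : #|nbr S d'.1| = 2 \/ #|nbr S d'.1| = 3.
- by have := deg _ d'S; lia.
- right; have [|d'' d''D Ed''] := @forward_onto S d' _ d'D; first by rewrite inE d2.
  have it i : iter i.+1 (forward S) d'' = iter i (forward S) d' by rewrite iterSr Ed''.
  exists d''; first by rewrite -Ed' -it.
  by case=> [|i] // ik; rewrite it dd'.
- by left; exists k => //; exists d' => //; rewrite inE d'D d3.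
Qed.

(** Without a thread, the k first iterates of the darts that leave vertices of
    degree 3 cover all darts that enter vertices of degree 2. *)
Lemma exists_thread S k : (forall x, x \in S -> 1 < #|nbr S x| <= 3) ->
  3 * k * #|of_degree S 3| < 2 * #|of_degree S 2| ->
  exists x : nat -> G, thread S x k.+1.
Proof.
move=> deg; rewrite -card_darts_into mulnAC -card_darts_from => lt.
pose img := [set iter p.2 (forward S) p.1 |
    p : (G * G) * 'I_k in setX (darts_from S 3) [set: 'I_k]].
have : ~~ (darts_into S 2 \subset img).
  apply: contraL lt => /subset_leq_card; rewrite -leqNgt => le.
  apply: leq_trans le (leq_trans (leq_imset_card _ _) _).
  by rewrite cardsX cardsT card_ord.
case/subsetPn => d dD dN.
have [[j jk [d' d'D E]]|[d' _ dd']] := backtrack k deg dD.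
  by case/imsetP: dN; exists (d', Ordinal jk); rewrite ?in_setX ?d'D ?inE.
exists (fun i => (iter i (forward S) d').1).
have dart i : i <= k.+1 -> iter i (forward S) d' \in darts S.
  by case: i => [|i] ik; [have := dd' 0 isT; rewrite inE => /andP[]
                         | case: (forward_dart (dd' i ik))].
have dartP i : i <= k.+1 -> let e := iter i (forward S) d' in
    [&& e.1 \in S, e.2 \in S & adj e.1 e.2].
  by move/dart; rewrite inE.
split; first split.
- by move=> i ik; have /and3P[] := dartP i ik.
- by move=> i ik /esym/eqP; apply/negP; case: (forward_dart (dd' i _)).
- case=> [_|i ik]; first by case/and3P: (dartP 0 isT).
  by case/and3P: (dartP i ik).
- by case=> [|i] //= ik; have := dd' i ik; rewrite inE => /andP[_ /eqP].
Qed.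

(** * Density *)

Lemma sum_nbr S : (forall x, x \in S -> 1 < #|nbr S x| <= 3) ->
  let n i := #|of_degree S i| in
  #|S| = n 2 + n 3 /\ \sum_(x in S) #|nbr S x| = 2 * n 2 + 3 * n 3.
Proof.
move=> deg n.
have nE i : n i = \sum_(x in S) (#|nbr S x| == i).
  by rewrite /n -sum1_card [LHS]big_mkcond [RHS]big_mkcond; apply: eq_bigr => x _;
    rewrite inE; case: (x \in S); case: eqP.
split.
  rewrite -sum1_card !nE -big_split; apply: eq_bigr => x /deg.
  by case: #|_| => [|[|[|[|]]]].
rewrite !nE !big_distrr -big_split; apply: eq_bigr => x /deg.
by case: #|_| => [|[|[|[|]]]].
Qed.

(** The half of the handshake lemma that turns the bound on edge densities into
    one on degrees: sending y to the edge x y injects the neighbours of x into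
    the edges at x. *)
Lemma sum_nbr_edges S :
  \sum_(x in S) #|nbr S x| <= 2 * #|[set e in edges G | e \subset S]|.
Proof.
set E := [set e in _ | _].
have -> : 2 * #|E| = \sum_(e in E) #|e|.
  rewrite mulnC -sum_nat_const; apply: eq_bigr => e.
  by rewrite inE => /andP[/card_edge-> _].
have -> : \sum_(e in E) #|e| = \sum_(x in S) #|[set e in E | x \in e]|.
  rewrite (eq_bigr (fun e : {set G} => \sum_(x in S) (x \in e))); last first.
    move=> e; rewrite inE => /andP[_ /subsetP eS]; rewrite -sum1_card.
    rewrite [LHS]big_mkcond [RHS]big_mkcond; apply: eq_bigr => x _.
    by case xe: (x \in e); [rewrite eS | case: ifP].
  rewrite exchange_big; apply: eq_bigr => x _.
  rewrite -sum1_card [LHS]big_mkcond [RHS]big_mkcond; apply: eq_bigr => e _.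
  by rewrite [in RHS]inE; case: (e \in E); case: (x \in e).
apply: leq_sum => x xS.
have <- : #|[set [set x; y] | y in nbr S x]| = #|nbr S x|.
  apply: card_in_imset => y z; rewrite !inE => /andP[_ xy] /andP[_ xz] E2.
  have : y \in [set x; z] by rewrite -E2 !inE eqxx orbT.
  by rewrite !inE => /orP[/eqP yx|/eqP //]; rewrite yx adj_irr in xy.
apply/subset_leq_card/subsetP => e /imsetP[y]; rewrite inE => /andP[yS xy] ->.
rewrite 2!inE !set21 andbT; apply/andP; split; first by apply/edgesP; exists x, y.
by apply/subsetP => z; rewrite !inE => /orP[]/eqP->.
Qed.

Lemma mad_sum_nbr S : (mad G < 2 + 2 / 23)%R -> S != set0 ->
  23 * \sum_(x in S) #|nbr S x| < 48 * #|S|.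
Proof.
move=> madG S0; have := sum_nbr_edges S; set E := [set e in _ | _] => sE.
have : ((2 * #|E|)%:R / #|S|%:R <= mad G)%R.
  apply: (Order.TotalTheory.bigmax_sup (S, E)) => //=.
  rewrite S0 andbT; apply/andP; split.
    by apply/subsetP => e; rewrite inE => /andP[].
  by apply/forall_inP => e; rewrite inE => /andP[].
move=> /Order.POrderTheory.le_lt_trans/(_ madG).
have S1 : (0 < #|S|%:R :> rat)%R by rewrite Num.Theory.ltr0n card_gt0.
rewrite Num.Theory.ltr_pdivrMr // => lt.
suff : ((23 * (2 * #|E|))%:R < (48 * #|S|)%:R :> rat)%R.
  by rewrite Num.Theory.ltr_nat; lia.
by rewrite GRing.natrM [in X in (_ < X)%R]GRing.natrM; lra.
Qed.

(** * The colouring *)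

Lemma exists_petersen_map S : subcubic G -> girth_geq G 8 ->
  (mad G < 2 + 2 / 23)%R -> exists phi, petersen_map S phi.
Proof.
move=> sG gG mG; have [k] := ubnP #|S|; elim: k S => // k IH S ltk.
have [->|S0] := eqVneq S set0.
  by exists (fun _ => (0, 1)); split=> // x y; rewrite inE.
case: (pickP [pred x in S | #|nbr S x| <= 1]) => [x /= /andP[xS dx]|no].
  have [|phi phiP] := IH (S :\ x); last exact: extend_leaf phiP.
  by rewrite (cardsD1 x S) xS in ltk.
have deg x : x \in S -> 1 < #|nbr S x| <= 3.
  by move=> xS; rewrite nbr_le3 // andbT ltnNge; have := no x; rewrite /= xS /= => ->.
have [x tx] : exists x : nat -> G, thread S x 8.
  apply: exists_thread => //; have := mad_sum_nbr mG S0.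
  by have [-> ->] := sum_nbr deg; lia.
have [|phi phiP] := IH (S :\: [set x i | i : 'I_10 & 1 < i < 8]);
  last exact: extend_thread phiP.
apply: leq_trans (_ : #|S| <= k); last by [].
apply: proper_card; apply/properP; split; first exact: subsetDl.
have [_ xS _] := tx; exists (x 2); first exact: xS.
rewrite inE negb_and negbK; apply/orP; left.
by apply/imsetP; exists (Ordinal (isT : 2 < 10)); rewrite ?inE.
Qed.

(** A conflict between edges w x and y z of one colour, joined by an edge x y,
    maps to a walk in the Petersen graph that contradicts [fifth_distance2]; and if
    w = y, then x y is itself the first of the two edges. *)
Lemma petersen_map_colorable phi : petersen_map setT phi -> strong_edge_colorable G 5.
Proof.
move=> [phiP phiA phiI].
have A x y : adj x y -> padj (phi x) (phi y) by apply: phiA; rewrite inE.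
have I x y z : adj x y -> adj x z -> y != z -> phi y <> phi z.
  by apply: phiI; rewrite inE.
(* For e = x y this is the missing element of phi x and phi y; as a sum over e it
   needs no choice of an order of the ends. *)
pose col (e : {set G}) := 10 - \sum_(x in e) ((phi x).1 + (phi x).2).
have colE x y : adj x y -> col [set x; y] = fifth (phi x) (phi y).
  move=> xy; rewrite /col big_setU1 ?big_set1 // inE.
  by apply: contraTneq xy => ->; rewrite adj_irr.
pose c := [ffun e : edge G => inord (col (val e)) : 'I_5].
have cE e : c e = col (val e) :> nat.
  rewrite ffunE inordK //; case: e => /= e /edgesP[x [y [xy ->]]].
  by rewrite colE // fifth_lt // A.
have edge_at e x : e \in edges G -> x \in e -> exists2 y, adj x y & e = [set x; y].
  case/edgesP => u [v [uv ->]]; rewrite !inE => /orP[]/eqP->; first by exists v.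
  by exists u; rewrite 1?adj_sym // setUC.
have proper (e f : edge G) : e != f -> ~~ [disjoint val e & val f] -> c e != c f.
  move=> ef /pred0Pn[x /= /andP[xe xf]].
  have [y xy Ee] := edge_at _ _ (valP e) xe; have [z xz Ef] := edge_at _ _ (valP f) xf.
  apply/eqP => /(congr1 val) /=; rewrite !cE Ee Ef !colE //.
  apply: fifth_adjacent; rewrite ?A //; apply: (I x) => //.
  by apply: contraNneq ef => yz; apply/eqP/val_inj; rewrite Ee Ef yz.
apply/existsP; exists c; apply/andP; split.
  apply/forallP => e; apply/forallP => f; apply/implyP => /andP[ef nd].
  exact: proper.
apply/forallP => i; have classP e : reflect (e \in edges G /\ col e = i)
    (e \in color_class c i).
  apply: (iffP imsetP) => [[f]|[eE ei]].
    by rewrite inE => /eqP fi ->; rewrite -cE fi (valP f).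
  by exists (exist _ e eE : edge G) => //; rewrite inE -val_eqE /= cE ei.
apply/andP; split; first (apply/andP; split).
- by apply/subsetP => e /classP[].
- apply/trivIsetP => e f /classP[eE ei] /classP[fE fi] ef.
  apply: contraTT isT => nd.
  have := proper (exist _ e eE) (exist _ f fE) ef nd.
  by rewrite -val_eqE /= !cE /= ei fi eqxx.
apply/eqP/setP => e; rewrite inE; apply/andP/idP => [[eE eM]|eM]; last first.
  by split; [case/classP: eM | apply: bigcup_sup].
apply/classP; split=> //; have [x [y [xy Ee]]] := edgesP _ eE.
have /bigcupP[f /classP[fE fi] xf] : x \in cover (color_class c i).
  by apply: (subsetP eM); rewrite Ee set21.
have /bigcupP[g /classP[gE gi] yg] : y \in cover (color_class c i).
  by apply: (subsetP eM); rewrite Ee set22.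
have [w xw Ef] := edge_at _ _ fE xf; have [z yz Eg] := edge_at _ _ gE yg.
case: (eqVneq w y) => wy; first by rewrite -fi Ef wy Ee.
have := @fifth_distance2 (phi w) (phi x) (phi y) (phi z).
rewrite -(colE y z) // -Eg gi.
have wx : adj w x by rewrite adj_sym.
rewrite -(colE w x) // setUC -Ef fi !A // => /(_ isT isT isT) [] //.
exact: (I x).
Qed.

End Graph.

Theorem theorem3p8 (G : sgraph) :
  subcubic G -> girth_geq G 8 -> (mad G < 2 + 2 / 23)%R ->
  strong_chromatic_index G <= 5.
Proof.
move=> sG gG mG; have [phi phiP] := exists_petersen_map setT sG gG mG.
rewrite /strong_chromatic_index; case: ex_minnP => k _; apply.
exact: petersen_map_colorable phiP.
Qed.
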